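(* Consider the multidimensional platform game of the context, with a finite electorate centrally symmetric around $\mu$. The function $$\Phi(x_A,x_B)=V_A(x_A,x_B)-\frac{\|x_B-\mu\|^2}{\phi}=V_B(x_A,x_B)-\frac{\|x_A-\mu\|^2}{\phi}$$ is well defined on $D^2$ (the two expressions coincide there) and is an exact potential of the game with platforms restricted to $D$: for all $x_A,x_A',x_B,x_B'\in D$, $V_A(x_A',x_B)-V_A(x_A,x_B)=\Phi(x_A',x_B)-\Phi(x_A,x_B)$ and $V_B(x_A,x_B')-V_B(x_A,x_B)=\Phi(x_A,x_B')-\Phi(x_A,x_B)$. The set of pure-strategy Nash equilibria of the game on $D^2$ coincides with that of the unrestricted game on $(\mathbb R^K)^2$. Consequently, every global maximizer of $\Phi$ on $D^2$ is a Nash equilibrium of the unrestricted game, and a pure-strategy Nash equilibrium exists.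
   Context: $K\ge2$. There are finitely many voter types $I=\{1,\dots,N\}$, $N\ge2$, with shares $s_i>0$, $\sum_i s_i=1$, and distinct bliss points $x_i\in\mathbb R^K$. The electorate is centrally symmetric around $\mu\in\mathbb R^K$: for every type $i$ there is a type $\bar i$ with $x_{\bar i}=2\mu-x_i$ and $s_{\bar i}=s_i$. Parties $A,B$ simultaneously choose platforms $x_A,x_B\in\mathbb R^K$ (unrestricted game). Let $\Delta_i(x_A,x_B)=\|x_B-x_i\|^2-\|x_A-x_i\|^2$ (Euclidean norm). A common shock $\epsilon$ is uniform on $[-\phi,\phi]$. Let $D=\prod_{k=1}^K[\min_i x_i^k,\max_i x_i^k]$; the wide-support condition is $\phi>\sup_{a,b\in D,\,i\in I}|\Delta_i(a,b)|$. Vote shares are $S_A(x_A,x_B,\epsilon)=\sum_i s_i\mathbf 1\{\Delta_i(x_A,x_B)\ge\epsilon\}$ and $S_B=1-S_A$. The power rule $\rho:[0,1]\to\mathbb R$ is strictly increasing (possibly discontinuous) with $\rho(s)+\rho(1-s)=\bar\rho$ for all $s$; $U:[\rho(0),\rho(1)]\to\mathbb R$ is continuous, strictly increasing and strictly concave; $\nu=U\circ\rho$, normalized so that $\nu(1)-\nu(0)=1$. Payoffs are $V_p(x_A,x_B)=\mathbb E_\epsilon[\nu(S_p(x_A,x_B,\epsilon))]$, $p=A,B$. *)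

(* Defs.v *)
(* MathComp / MathComp-Analysis *)
From HB Require Import structures.
From mathcomp Require Import all_boot all_order all_algebra.
From mathcomp Require Import all_classical all_reals all_analysis.

Set Implicit Arguments.
Unset Strict Implicit.
Unset Printing Implicit Defensive.

Import Order.TTheory GRing.Theory Num.Theory.
Import numFieldNormedType.Exports.

Local Open Scope classical_set_scope.
Local Open Scope ring_scope.

(* The library norm on 'rV[R]_K is the sup norm, hence this definition. *)
Definition enorm (R : realType) (K : nat) (v : 'rV[R]_K) : R :=
  Num.sqrt (\sum_(k < K) v ord0 k ^+ 2).

Definition strictly_increasing_on (R : realType) (I : set R) (f : R -> R) : Prop :=
  forall s t : R, I s -> I t -> s < t -> f s < f t.

Definition strictly_concave_on (R : realType) (I : set R) (f : R -> R) : Prop :=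
  forall s t l : R, I s -> I t -> s != t -> 0 < l -> l < 1 ->
    l * f s + (1 - l) * f t < f (l * s + (1 - l) * t).

Section Electorate.
Variables (R : realType) (K N : nat).
Variables (s : 'I_N -> R) (x : 'I_N -> 'rV[R]_K).

Definition centrally_symmetric (mu : 'rV[R]_K) : Prop :=
  forall i, exists j, x j = mu *+ 2 - x i /\ s j = s i.

(* The finite minima and maxima are taken in \bar R, where they have the
   neutral elements +oo and -oo; they are finite as soon as N > 0. *)
Definition bliss_box : set 'rV[R]_K :=
  [set a : 'rV[R]_K | forall k : 'I_K,
    (\big[Order.min/+oo]_(i < N) (x i ord0 k)%:E <= (a ord0 k)%:E
       <= \big[Order.max/-oo]_(i < N) (x i ord0 k)%:E)%E].

Definition Delta (i : 'I_N) (xA xB : 'rV[R]_K) : R :=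
  enorm (xB - x i) ^+ 2 - enorm (xA - x i) ^+ 2.

Definition wide_support (phi : R) : Prop :=
  (ereal_sup [set y : \bar R | exists a b i,
     [/\ bliss_box a, bliss_box b & y = (`|Delta i a b|%R)%:E]] < phi%:E)%E.

Definition shareA (xA xB : 'rV[R]_K) (eps : R) : R :=
  \sum_(i < N) s i * (eps <= Delta i xA xB)%R%:R.

Definition shareB (xA xB : 'rV[R]_K) (eps : R) : R := 1 - shareA xA xB eps.

Variables (phi : R) (hphi : - phi < phi) (nu : R -> R).

(* The integrands take finitely many values, so `fine` loses nothing. *)
Definition payoffA (xA xB : 'rV[R]_K) : R :=
  fine 'E_(uniform_prob hphi)[fun eps => nu (shareA xA xB eps)]%E.

Definition payoffB (xA xB : 'rV[R]_K) : R :=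
  fine 'E_(uniform_prob hphi)[fun eps => nu (shareB xA xB eps)]%E.

Definition Phi (mu xA xB : 'rV[R]_K) : R :=
  payoffA xA xB - enorm (xB - mu) ^+ 2 / phi.

End Electorate.

Definition exact_potential (R : realType) (T : Type) (X : set T)
    (VA VB F : T -> T -> R) : Prop :=
  (forall a a' b, X a -> X a' -> X b -> VA a' b - VA a b = F a' b - F a b) /\
  (forall a b b', X a -> X b -> X b' -> VB a b' - VB a b = F a b' - F a b).

(* Pure-strategy Nash equilibria when both players choose from X. *)
Definition nash (R : realType) (T : Type) (X : set T) (VA VB : T -> T -> R) :
    set (T * T) :=
  [set p | [/\ X p.1, X p.2,
     forall a, X a -> VA a p.2 <= VA p.1 p.2 &
     forall b, X b -> VB p.1 b <= VB p.1 p.2]].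

Definition global_maximizer (R : realType) (T : Type) (X : set T)
    (F : T -> T -> R) (p : T * T) : Prop :=
  [/\ X p.1, X p.2 & forall a b, X a -> X b -> F a b <= F p.1 p.2].

(* Main.v *)
(* Write Delta_i(a, b) for the advantage of a over b with voter i, and average
   over the shock the value of the coalition {i | eps <= Delta_i}. Splitting the
   shocks by coalition T gives a finite sum of the values of T weighted by
   interval lengths, the interval of T being bounded by minima of Delta_i over T
   and maxima off T. Three facts can be read off this sum. It is continuous. The
   change eps -> - eps shows V_B(a, b) = V_A(b, a). Adding a constant c to all
   Delta_i only moves the lengths of the full and the empty coalition, by c and
   - c, as long as no Delta_i leaves [- phi, phi]. Central symmetry turns the
   profile Delta(a, b), up to a permutation preserving shares, into Delta(b, a)
   shifted by 2 (|b - mu|^2 - |a - mu|^2); hence V_A - V_B on the box, and the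
   potential.

   Clamping a platform a outside the box D to a point a' of D brings it strictly
   closer to every bliss point. So deviations outside D never help. Conversely,
   let (a, b) be an equilibrium with a outside D. Since B could imitate a, some
   voter is not sure to vote for A, that is Delta_i(a, b) < phi. As
   Delta_i(a', b) >= - |a' - x_i|^2 > - phi, moving to a' wins voter i on a set
   of shocks of positive probability, a contradiction. *)

Require Import Defs.
From HB Require Import structures.
From mathcomp Require Import all_boot all_order all_algebra.
From mathcomp Require Import all_classical all_reals all_analysis.
From mathcomp Require Import ring lra.

Set Implicit Arguments.
Unset Strict Implicit.
Unset Printing Implicit Defensive.

Import Order.TTheory GRing.Theory Num.Theory.
Import numFieldNormedType.Exports.

Local Open Scope classical_set_scope.
Local Open Scope ring_scope.

(** * Averages over a uniform shock of the value of the supporting coalition *)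

Section StepMean.
Variables (R : realType) (N : nat) (phi : R) (hphi : - phi < phi).
Implicit Types (d : 'I_N -> R) (T : {set 'I_N}) (g : {set 'I_N} -> R).

Definition supporters d (eps : R) : {set 'I_N} := [set i | eps <= d i]%SET.

Definition step_mean g d : R :=
  (\int[uniform_prob hphi]_eps g (supporters d eps))%R.

(** The default [phi] cuts the minimum at the top of the support of the shock, and is the value for
    empty [T]. *)
Definition win_min T d : R := \big[Num.min/phi]_(i in T) d i.

(* Length of the set of shocks in [-phi, phi] at which the supporters of the
   first party are exactly T; -d i rather than d i on the complement of T turns
   a maximum into a minimum and makes the formula symmetric. *)
Definition win_length T d : R :=
  Num.max 0 (win_min T d + win_min (~: T) (fun i => - d i)).

Lemma phi_gt0 : 0 < phi.
Proof. by move: hphi; lra. Qed.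

Lemma supporters_eqE T d eps :
  (supporters d eps == T) =
  [forall (i | i \in T), eps <= d i] && [forall (i | i \in ~: T), d i < eps].
Proof.
apply/eqP/andP => [<-|[/forall_inP h1 /forall_inP h2]].
  by split; apply/forall_inP => i; rewrite !inE// -ltNge.
apply/setP => i; rewrite inE; have [/h1//|iT] := boolP (i \in T).
by apply/negbTE; rewrite -ltNge; apply: h2; rewrite inE.
Qed.

Lemma measurable_supporters_eq T d :
  measurable [set eps : R | supporters d eps = T].
Proof.
apply: measurable_realfun.is_interval_measurable.
move=> e1 e2 /= h1 h2 e /andP[e1e ee2].
apply/setP => i; rewrite inE; apply/idP/idP => h.
  by rewrite -h1 inE (le_trans e1e).
by move: h; rewrite -h2 inE; exact: le_trans.
Qed.

(** Voters off [T] need [d i < eps], hence the open left end: it is the maximum of [- phi] and of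
    the [d i] off [T], written as the opposite of a minimum. *)
Lemma win_intervalE T d eps :
  (- win_min (~: T) (fun i => - d i) < eps <= win_min T d) =
  (supporters d eps == T) && (- phi < eps <= phi).
Proof.
rewrite ltrNl supporters_eqE /win_min.
apply/andP/andP => [[/bigmin_gtP[h1 h2] /bigmin_geP[h3 h4]]|].
  split; last by rewrite h3 ltrNl h1.
  by apply/andP; split; apply/forall_inP => i iT; rewrite ?h4// -ltrN2 h2.
move=> [/andP[/forall_inP h1 /forall_inP h2] /andP[h3 h4]].
split; first by apply/bigmin_gtP; rewrite ltrNl h3; split=> // i /h2; rewrite ltrN2.
by apply/bigmin_geP; split.
Qed.

(** The event and the half-open interval of [win_intervalE] differ at most in the null point
    [- phi]. The [max] with 0 in [win_length] covers the empty interval. *)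
Lemma lebesgue_supporters_eq T d :
  lebesgue_measure ([set eps : R | supporters d eps = T] `&` `[- phi, phi]) =
  (win_length T d)%:E.
Proof.
set A := _ `&` _.
pose I : set R := `]- win_min (~: T) (fun i => - d i), win_min T d]%classic.
have muI : lebesgue_measure I = (win_length T d)%:E.
  rewrite /I lebesgue_measure_itv/= lte_fin -EFinB opprK /win_length.
  case: ltP => h; congr EFin; first by rewrite max_r// -lerBlDr sub0r ltW.
  by rewrite max_l// -lerBrDr sub0r.
have mA : measurable A.
  by apply: measurableI; [exact: measurable_supporters_eq|exact: measurable_itv].
have mI : measurable I by exact: measurable_itv.
have IA : I `<=` A.
  move=> e; rewrite /I /A /= !in_itv/= win_intervalE => /andP[/eqP -> /andP[h ->]].
  by rewrite (ltW h).
have AI : A `<=` I `|` [set - phi].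
  move=> e; rewrite /I /A /= !in_itv/= win_intervalE => -[-> /andP[h1 h2]].
  have [->|ne] := eqVneq e (- phi); first by right.
  by left; rewrite eqxx h2 andbT lt_neqAle eq_sym ne.
pose J : set R := I `|` [set - phi].
have m1 : measurable [set - phi] by exact: measurable_set1.
have mJ : measurable J by exact: measurableU.
have muJ : (lebesgue_measure J <= lebesgue_measure I)%E.
  rewrite (le_trans (measureU2 lebesgue_measure mI m1))//.
  by rewrite [X in (_ + X <= _)%E]lebesgue_measure_set1 adde0.
rewrite -muI; apply/eqP; rewrite eq_le; apply/andP; split.
  by apply: le_trans muJ; apply: le_measure; rewrite ?inE.
by apply: le_measure; rewrite ?inE.
Qed.

Lemma prob_supporters_eq T d :
  uniform_prob hphi [set eps : R | supporters d eps = T] =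
  ((phi *+ 2)^-1 * win_length T d)%:E.
Proof.
rewrite /uniform_prob integral_uniform_pdf.
set A := _ `&` _.
have mA : measurable A.
  by apply: measurableI; [exact: measurable_supporters_eq|exact: measurable_itv].
transitivity (\int[lebesgue_measure]_(x in A) (cst ((phi *+ 2)^-1)%:E x))%E.
  apply: eq_integral => e; rewrite inE /A /= in_itv/= => -[_ h].
  by rewrite /uniform_pdf h opprK mulr2n.
by rewrite integral_cst// EFinM; congr (_ * _)%E; exact: lebesgue_supporters_eq.
Qed.

Lemma step_fun_sumE g d eps :
  g (supporters d eps) =
  \sum_T g T * \1_[set e : R | supporters d e = T] eps.
Proof.
rewrite (bigD1 (supporters d eps))//= big1 ?addr0.
  by rewrite indicE mem_set// mulr1.
by move=> T /eqP ne; rewrite indicE memNset ?mulr0// => /esym.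
Qed.

Lemma integrable_step_term g d T :
  (uniform_prob hphi).-integrable setT
    (fun eps => (g T)%:E * (\1_[set e : R | supporters d e = T] eps)%:E)%E.
Proof.
apply: integrableZl => //.
exact: (@integrable_indic _ _ _ (uniform_prob hphi) _ (measurable_supporters_eq _ _)).
Qed.

Lemma integrable_step g d :
  (uniform_prob hphi).-integrable setT (EFin \o (fun eps => g (supporters d eps))).
Proof.
apply: eq_integrable (integrable_sum _ _ (fun T _ => integrable_step_term g d T)) => //.
  by move=> e _ /=; rewrite step_fun_sumE sumEFin.
Qed.

Lemma step_meanE g d :
  step_mean g d = (phi *+ 2)^-1 * \sum_T g T * win_length T d.
Proof.
rewrite /step_mean /Rintegral.
under eq_integral do rewrite step_fun_sumE -sumEFin.
under eq_integral do under eq_bigr do rewrite EFinM.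
rewrite (integral_sum _ (integrable_step_term g d))//.
rewrite (eq_bigr (fun T => (g T * ((phi *+ 2)^-1 * win_length T d))%:E)).
  by rewrite sumEFin/= mulr_sumr; apply: eq_bigr => T _; rewrite mulrCA.
move=> T _; rewrite integralZl//=; last first.
  exact: (@integrable_indic _ _ _ (uniform_prob hphi) _ (measurable_supporters_eq _ _)).
rewrite integral_indic ?setIT//; last exact: measurable_supporters_eq.
by rewrite EFinM; congr (_ * _)%E; exact: prob_supporters_eq.
Qed.

(** Under the integral, the change of sign of the shock is exact only off the ties [eps = d i]. In
    the length formula no null set appears: complementing [T] just exchanges the two minima. *)
Lemma step_meanN g d :
  step_mean g (fun i => - d i) = step_mean (fun T => g (~: T)) d.
Proof.
rewrite !step_meanE (reindex_inj (inv_inj (@finset.setCK _)))/=; congr (_ * _).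
apply: eq_bigr => T _; congr (_ * Num.max 0 _); rewrite finset.setCK addrC.
by congr (_ + _); apply: eq_bigr => i _; rewrite opprK.
Qed.

Lemma step_mean_perm g d (f : 'I_N -> 'I_N) :
  (forall T, g (f @^-1: T) = g T) -> step_mean g (d \o f) = step_mean g d.
Proof.
move=> gf; apply: eq_Rintegral => e _; rewrite -[RHS]gf; congr g.
by apply/setP => i; rewrite !inE.
Qed.

(** The default [phi] does not move with [c]. The two bounds keep all entries below it, so that over
    a nonempty [T] the minimum is attained at an entry. *)
Lemma win_min_shift T d c : T != finset.set0 ->
  (forall i, d i <= phi) -> (forall i, d i + c <= phi) ->
  win_min T (fun i => d i + c) = win_min T d + c.
Proof.
case/finset.set0Pn => i0 i0T d1 d2; apply/eqP; rewrite eq_le; apply/andP; split.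
  rewrite -lerBlDr; apply/bigmin_geP; split.
    by rewrite lerBlDr (le_trans (bigmin_le_cond _ _ i0T))// lerD2r d1.
  by move=> i iT; rewrite lerBlDr; exact: bigmin_le_cond.
apply/bigmin_geP; split.
  by rewrite (le_trans _ (d2 i0))// lerD2r; exact: bigmin_le_cond.
by move=> i iT; rewrite lerD2r; exact: bigmin_le_cond.
Qed.

Lemma win_min_ge T d : (forall i, - phi <= d i) -> - phi <= win_min T d.
Proof. by move=> dl; apply/bigmin_geP; split=> //; exact: ltW. Qed.

Lemma win_min0 d : win_min finset.set0 d = phi.
Proof. by rewrite /win_min big_set0. Qed.

(** If [T] is neither empty nor full, the two minima move by [c] and [- c], which cancel. Otherwise
    the minimum over the empty side stays at [phi] and only the other one moves; all minima being at
    least [- phi], the [max] with 0 is then inactive. *)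
Lemma win_length_shift T d c :
  (forall i, `|d i| <= phi) -> (forall i, `|d i + c| <= phi) ->
  win_length T (fun i => d i + c) - win_length T d =
  c * ((T == finset.setT)%:R - (T == finset.set0)%:R).
Proof.
move=> d1 d2.
have dl i : d i <= phi by have := d1 i; rewrite ler_norml => /andP[].
have dg i : - d i <= phi by have := d1 i; rewrite ler_norml lerNl => /andP[].
have cl i : d i + c <= phi by have := d2 i; rewrite ler_norml => /andP[].
have cg i : - d i - c <= phi.
  by have := d2 i; rewrite ler_norml lerNl opprD => /andP[].
have dm : - phi <= win_min T d.
  by apply: win_min_ge => i; rewrite lerNl.
have dm' : - phi <= win_min (~: T) (fun i => - d i).
  by apply: win_min_ge => i; rewrite lerN2.
have cm : - phi <= win_min T (fun i => d i + c).
  by apply: win_min_ge => i; rewrite lerNl opprD.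
have cm' : - phi <= win_min (~: T) (fun i => - (d i + c)).
  by apply: win_min_ge => i; rewrite lerN2.
have E1 (h : T != finset.set0) := win_min_shift h dl cl.
have E2 : ~: T != finset.set0 -> win_min (~: T) (fun i => - (d i + c)) =
    win_min (~: T) (fun i => - d i) - c.
  move=> /win_min_shift <- //.
  by congr win_min; apply/funext => i; rewrite opprD.
rewrite /win_length.
have [T0|T0] := eqVneq T finset.set0; have [T1|T1] := eqVneq T finset.setT.
(* Empty and full at once: there are no voters, and both minima equal [phi]. *)
- rewrite subrr mulr0; apply/eqP; rewrite subr_eq0; apply/eqP.
  by rewrite T0 finset.setC0 -T1 T0 !win_min0.
- move: dm' cm'; rewrite E2; last first.
    by apply: contraNneq T1 => /(congr1 (@finset.setC 'I_N)); rewrite finset.setCK finset.setC0 => ->.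
  rewrite T0 !win_min0 => dm' cm'.
  rewrite !max_r /=; [lra..].
- move: dm cm; rewrite E1// T1 finset.setCT !win_min0 => dm cm.
  rewrite !max_r /=; [lra..].
- rewrite E1// E2; last first.
    by apply: contraNneq T1 => /(congr1 (@finset.setC 'I_N)); rewrite finset.setCK finset.setC0 => ->.
  by rewrite addrACA subrr addr0 !subrr mulr0.
Qed.

Lemma step_mean_shift g d c :
  (forall i, `|d i| <= phi) -> (forall i, `|d i + c| <= phi) ->
  step_mean g (fun i => d i + c) - step_mean g d =
  c / (phi *+ 2) * (g finset.setT - g finset.set0).
Proof.
move=> d1 d2; rewrite !step_meanE -mulrBr -sumrB.
under eq_bigr do rewrite -mulrBr win_length_shift// mulrCA mulrBr.
rewrite -mulr_sumr sumrB mulrCA mulrA; congr (_ * (_ - _)).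
  by rewrite (bigD1 [set: 'I_N]%SET)//= eqxx mulr1 big1 ?addr0// => T /negbTE ->; rewrite mulr0.
by rewrite (bigD1 finset.set0)//= eqxx mulr1 big1 ?addr0// => T /negbTE ->; rewrite mulr0.
Qed.

Lemma continuous_win_min (X : topologicalType) T (F : 'I_N -> X -> R) :
  (forall i, continuous (F i)) -> continuous (fun p => win_min T (F^~ p)).
Proof.
by move=> cF; apply: (continuous_big min_continuous) => i _; exact: cF.
Qed.

(** The values [g T] are constants here, so jumps of the power rule do no harm: only the lengths
    vary with [p], and they are built from minima, maxima and sums. *)
Lemma continuous_step_mean (X : topologicalType) g (F : 'I_N -> X -> R) :
  (forall i, continuous (F i)) -> continuous (fun p => step_mean g (F^~ p)).
Proof.
move=> cF.
have -> : (fun p => step_mean g (F^~ p)) =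
    (fun p => (phi *+ 2)^-1 * \sum_T g T * win_length T (F^~ p)).
  by apply/funext => p; rewrite step_meanE.
move=> p; apply: cvgM; first exact: cvg_cst.
apply: (continuous_big add_continuous) => T _ {}p.
apply: cvgM; first exact: cvg_cst.
have cN i : continuous (fun p => - F i p) by move=> q; apply: cvgN; exact: cF.
apply: (@continuous_max R X (cst 0)
    (fun q => win_min T (F^~ q) + win_min (~: T) (fun i => - F i q))).
  exact: cvg_cst.
by apply: cvgD; exact: continuous_win_min.
Qed.

Lemma supporters_le d d' eps :
  (forall i, d i <= d' i) -> supporters d eps \subset supporters d' eps.
Proof. by move=> dd'; apply/fintype.subsetP => i; rewrite !inE => /le_trans; apply. Qed.

Lemma step_mean_le g d d' :
  (forall T T', T \subset T' -> g T <= g T') ->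
  (forall i, d i <= d' i) -> step_mean g d <= step_mean g d'.
Proof.
move=> gm dd'; apply: le_Rintegral => //; try exact: integrable_step.
by move=> e _; apply/gm/supporters_le.
Qed.

Lemma prob_itvE a b : - phi <= a -> a < b -> b <= phi ->
  uniform_prob hphi `]a, b] = ((phi *+ 2)^-1 * (b - a))%:E.
Proof.
move=> ha ab hb.
transitivity (\int[lebesgue_measure]_(x in `]a, b]) (cst ((phi *+ 2)^-1)%:E x))%E.
  apply: eq_integral => e; rewrite inE /= in_itv/= => /andP[h1 h2].
  by rewrite /uniform_pdf (le_trans ha (ltW h1)) (le_trans h2 hb) opprK mulr2n.
rewrite integral_cst; last exact: measurable_itv.
rewrite EFinM; congr (_ * _)%E.
by rewrite [LHS]lebesgue_measure_itv/= lte_fin ab EFinB.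
Qed.

(** At the shocks of []d i0, d' i0]] voter [i0] joins the coalition. The last two hypotheses on [i0]
    make this interval meet the support in positive length. *)
Lemma step_mean_lt g d d' i0 :
  (forall T T', T \proper T' -> g T < g T') ->
  (forall i, d i <= d' i) -> d i0 < d' i0 -> d i0 < phi -> - phi < d' i0 ->
  step_mean g d < step_mean g d'.
Proof.
move=> gm dd' lt0 ltphi gtphi.
(* A uniform lower bound for the gain from any proper enlargement; the default 1 only keeps it
   positive. *)
pose k := \big[Num.min/1]_(p : {set 'I_N} * {set 'I_N} | p.1 \proper p.2) (g p.2 - g p.1).
have k0 : 0 < k by apply: lt_bigmin => //= p /gm; rewrite subr_gt0.
have kP T T' : T \proper T' -> g T + k <= g T'.
  by move=> TT'; rewrite -lerBrDl; exact: (@bigmin_le_cond _ _ _ 1 (T, T') _ (fun p => g p.2 - g p.1)).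
pose a := Num.max (d i0) (- phi); pose b := Num.min (d' i0) phi.
have ab : a < b by rewrite lt_min !gt_max lt0 ltphi gtphi hphi.
have mI : measurable (`]a, b]%classic : set R) by exact: measurable_itv.
have i1 : (uniform_prob hphi).-integrable setT
    (EFin \o (\1_(`]a, b]%classic : set R) : R -> R)).
  exact: (@integrable_indic _ _ _ (uniform_prob hphi)).
have iI : (uniform_prob hphi).-integrable setT
    (EFin \o (fun e => k * \1_(`]a, b]%classic : set R) e)).
  by have := integrableZl measurableT k i1; apply: eq_integrable.
(* Adding and subtracting the mean of [k] times the indicator of []a, b]] reduces the strict
   inequality to a pointwise weak one. *)
have -> : step_mean g d = step_mean g d +
    (\int[uniform_prob hphi]_e (k * \1_(`]a, b]%classic : set R) e))%R
    - k * ((phi *+ 2)^-1 * (b - a)).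
  rewrite RintegralZl//.
  rewrite /Rintegral integral_indic// setIT.
  have := @prob_itvE a b _ ab; rewrite le_max ge_min !lexx !orbT => /(_ erefl erefl).
  by move=> /= ->; rewrite addrK.
rewrite ltrBlDr -[ltLHS]addr0 ler_ltD//; last first.
  by rewrite mulr_gt0// mulr_gt0 ?subr_gt0// invr_gt0 pmulrn_lgt0 ?phi_gt0.
rewrite /step_mean -RintegralD//; last exact: integrable_step.
apply: le_Rintegral => //; try exact: integrable_step.
  have := integrableD measurableT (integrable_step g d) iI.
  by apply: eq_integrable.
move=> e _; have sub := supporters_le e dd'.
rewrite indicE; have [eI|_] := boolP (e \in _); last first.
  rewrite mulr0 addr0; move: sub; rewrite finset.subEproper => /orP[/eqP->//|/gm/ltW//].
rewrite mulr1; apply: kP; rewrite fintype.properE sub; apply/fintype.subsetPn; exists i0.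
  all: move: eI; rewrite inE/= in_itv/= gt_max le_min => /andP[/andP[h1 _] /andP[h2 _]].
  by rewrite inE.
by rewrite inE -ltNge.
Qed.

End StepMean.

(** * Squared distances and clamping to an interval *)

Lemma enorm_sqr (R : realType) (K : nat) (v : 'rV[R]_K) :
  enorm v ^+ 2 = \sum_(k < K) v ord0 k ^+ 2.
Proof. by rewrite sqr_sqrtr// sumr_ge0// => k _; exact: sqr_ge0. Qed.

Lemma sqr_dist_clamp_le (R : realDomainType) (lo hi y t : R) : lo <= y <= hi ->
  (Num.max lo (Num.min hi t) - y) ^+ 2 <= (t - y) ^+ 2.
Proof.
move=> /andP[h1 h2]; have [h|h] := leP hi t.
  by rewrite max_r ?(le_trans h1)//; nra.
by have [h'|h'] := leP lo t => //; nra.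
Qed.

Lemma sqr_dist_clamp_lt (R : realDomainType) (lo hi y t : R) : lo <= y <= hi ->
  ~~ (lo <= t <= hi) -> (Num.max lo (Num.min hi t) - y) ^+ 2 < (t - y) ^+ 2.
Proof.
move=> /andP[h1 h2]; rewrite negb_and -!ltNge.
have [h|h] := leP hi t; last first.
  by rewrite (le_gtF (ltW h)) orbF => h'; rewrite max_l ?(ltW h')//; nra.
rewrite max_r ?(le_trans h1)// => /orP[h'|h']; last nra.
by have := lt_le_trans h' h1; lra.
Qed.

(** * Voter advantages and the box of bliss points *)

Section Platforms.
Variables (R : realType) (K N : nat) (x : 'I_N -> 'rV[R]_K).
Implicit Types (a b : 'rV[R]_K) (i : 'I_N).

Lemma DeltaE i a b : Delta x i a b =
  \sum_(k < K) (b ord0 k - x i ord0 k) ^+ 2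
  - \sum_(k < K) (a ord0 k - x i ord0 k) ^+ 2.
Proof.
rewrite /Delta !enorm_sqr; congr (_ - _); apply: eq_bigr => k _.
  by rewrite !mxE.
by rewrite !mxE.
Qed.

Lemma Delta_opp i a b : Delta x i b a = - Delta x i a b.
Proof. by rewrite /Delta opprB. Qed.

Lemma Deltaxx i a : Delta x i a a = 0.
Proof. by rewrite /Delta subrr. Qed.

(** Parallelogram law: the squared distances from [b] to [x i] and to its reflection add up to twice
    those from [b] and from [x i] to [mu]. The term in [x i] cancels between [a] and [b]. *)
Lemma Delta_reflect (mu : 'rV[R]_K) i j a b : x j = mu *+ 2 - x i ->
  Delta x j a b =
  Delta x i b a + (enorm (b - mu) ^+ 2 - enorm (a - mu) ^+ 2) *+ 2.
Proof.
move=> xj; rewrite !DeltaE !enorm_sqr -!sumrB mulr2n -!big_split/=.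
apply: eq_bigr => k _; rewrite xj !mxE; ring.
Qed.

(** One bliss point suffices to make the extended extrema finite, so the box is a product of real
    segments. *)
Lemma bliss_boxP : (0 < N)%N -> exists lo hi : 'I_K -> R,
  (forall i k, lo k <= x i ord0 k <= hi k) /\
  bliss_box x = [set a : 'rV[R]_K | forall k, a ord0 k \in `[lo k, hi k]].
Proof.
move=> N0; pose i0 := Ordinal N0.
pose m k := (\big[Order.min/+oo]_(i < N) (x i ord0 k)%:E)%E.
pose M k := (\big[Order.max/-oo]_(i < N) (x i ord0 k)%:E)%E.
have mx i k : (m k <= (x i ord0 k)%:E)%E by exact: bigmin_le.
have Mx i k : ((x i ord0 k)%:E <= M k)%E by exact: le_bigmax.
have mE k : m k = (fine (m k))%:E.
  rewrite fineK// fin_numE; apply/andP; split.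
    by rewrite gt_eqF//; apply: lt_bigmin => // i _; exact: ltNyr.
  by rewrite lt_eqF// (le_lt_trans (mx i0 k))// ltry.
have ME k : M k = (fine (M k))%:E.
  rewrite fineK// fin_numE; apply/andP; split.
    by rewrite gt_eqF// (lt_le_trans _ (Mx i0 k))// ltNyr.
  by rewrite lt_eqF//; apply: bigmax_lt => // i _; exact: ltry.
exists (fun k => fine (m k)), (fun k => fine (M k)); split.
  by move=> i k; rewrite -!lee_fin -mE -ME mx Mx.
apply/seteqP; split=> a /= h k.
  by have := h k; rewrite -/(m k) -/(M k) mE ME !lee_fin in_itv.
by have := h k; rewrite -/(m k) -/(M k) mE ME !lee_fin in_itv.
Qed.

Lemma bliss_box_bliss i : bliss_box x (x i).
Proof. by move=> k; apply/andP; split; [exact: bigmin_le|exact: le_bigmax]. Qed.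

Lemma compact_bliss_box : (0 < N)%N -> compact (bliss_box x).
Proof.
move=> /bliss_boxP[lo [hi [_ ->]]].
by apply: (@rV_compact R K (fun k => `[lo k, hi k]%classic)) => k; exact: segment_compact.
Qed.

(** Clamping lowers the squared distance strictly in an offending coordinate and raises it in none.
    A single [a'] serves all [b], whose distance appears on both sides. *)
Lemma bliss_box_dominates a : (0 < N)%N -> ~ bliss_box x a ->
  exists2 a', bliss_box x a' & forall i b, Delta x i a b < Delta x i a' b.
Proof.
move=> N0; have [lo [hi [xlh ->]]] := bliss_boxP N0 => aD.
have [k ak] : exists k, ~~ (lo k <= a ord0 k <= hi k).
  by apply: contra_notP aD => h k; rewrite in_itv/=; apply: contra_notT h => ?; exists k.
exists (\row_k Num.max (lo k) (Num.min (hi k) (a ord0 k))) => [k'|i b] /=.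
  have /andP[h1 h2] := xlh (Ordinal N0) k'.
  by rewrite mxE in_itv/= le_max lexx/= ge_max ge_min lexx (le_trans h1 h2).
rewrite !DeltaE ltrD2l ltrN2 (bigD1 k)//= [ltRHS](bigD1 k)//=.
rewrite ltr_leD//; first by rewrite mxE sqr_dist_clamp_lt.
by apply: ler_sum => j _; rewrite mxE sqr_dist_clamp_le.
Qed.

Lemma continuous_sqr_dist (T : topologicalType) (f : T -> 'rV[R]_K) (y : 'rV[R]_K) :
  continuous f -> continuous (fun p => \sum_(k < K) (f p ord0 k - y ord0 k) ^+ 2).
Proof.
move=> cf; apply: (continuous_big add_continuous) => k _ p.
apply: (@continuous_comp _ _ _ (fun q => f q ord0 k - y ord0 k) (fun r => r ^+ 2));
  last exact: exprn_continuous.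
apply: cvgB; last exact: cvg_cst.
apply: (@continuous_comp _ _ _ f (fun v : 'rV[R]_K => v ord0 k)); first exact: cf.
exact: coord_continuous.
Qed.

Lemma continuous_Delta i : continuous (fun p : 'rV[R]_K * 'rV[R]_K => Delta x i p.1 p.2).
Proof.
have -> : (fun p : 'rV[R]_K * 'rV[R]_K => Delta x i p.1 p.2) = (fun p =>
  \sum_(k < K) (p.2 ord0 k - x i ord0 k) ^+ 2
  - \sum_(k < K) (p.1 ord0 k - x i ord0 k) ^+ 2).
  by apply/funext => p; rewrite DeltaE.
move=> p; apply: cvgB.
  by apply: (@continuous_sqr_dist _ snd) => q; exact: cvg_snd.
by apply: (@continuous_sqr_dist _ fst) => q; exact: cvg_fst.
Qed.

Lemma wide_supportP (phi : R) i a b : wide_support x phi ->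
  bliss_box x a -> bliss_box x b -> `|Delta x i a b| < phi.
Proof.
move=> ws Da Db; rewrite -lte_fin; apply: le_lt_trans ws.
by apply: ereal_sup_ubound; exists a, b, i.
Qed.

End Platforms.

(** * Payoffs as means of coalition values; best replies and symmetry *)

Section Payoffs.
Variables (R : realType) (K N : nat) (s : 'I_N -> R) (x : 'I_N -> 'rV[R]_K).
Variables (phi : R) (hphi : - phi < phi) (nu : R -> R).
Hypotheses (s_gt0 : forall i, 0 < s i) (s_sum1 : \sum_(i < N) s i = 1).
Hypothesis nu_inc : strictly_increasing_on `[0, 1] nu.
Implicit Types (a b : 'rV[R]_K) (i : 'I_N) (T : {set 'I_N}).

Definition coalition_value T : R := nu (\sum_(i in T) s i).

Definition payoff a b : R :=
  step_mean hphi coalition_value (fun i => Delta x i a b).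

Lemma payoffA_payoff a b : payoffA s x hphi nu a b = payoff a b.
Proof.
rewrite /payoffA unlock /payoff /step_mean /Rintegral; congr fine.
apply: eq_integral => e _; congr (nu _)%:E; rewrite /shareA [RHS]big_mkcond/=.
by apply: eq_bigr => i _; rewrite inE; case: ifP; rewrite ?mulr1 ?mulr0.
Qed.

(** Party B collects the voters off the supporters of A, and [step_meanN] trades this complement for
    the sign of the advantages. *)
Lemma payoffB_payoff a b : payoffB s x hphi nu a b = payoff b a.
Proof.
have -> : payoff b a = step_mean hphi coalition_value (fun i => - Delta x i a b).
  by congr step_mean; apply/funext => i; rewrite Delta_opp.
rewrite step_meanN /payoffB unlock /step_mean /Rintegral; congr fine.
apply: eq_integral => e _; congr (nu _)%:E; rewrite /shareB -s_sum1 /shareA.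
rewrite -sumrB [RHS]big_mkcond/=; apply: eq_bigr => i _.
by rewrite !inE; case: (e <= _); rewrite ?mulr1 ?mulr0 ?subrr ?subr0.
Qed.

Lemma coalition_share_itv T : `[0, 1]%classic (\sum_(i in T) s i).
Proof.
rewrite /= in_itv/= sumr_ge0/= => [|i _]; last exact: ltW.
rewrite -s_sum1 [leRHS](bigID (mem T))/= lerDl sumr_ge0// => i _; exact: ltW.
Qed.

Lemma coalition_value_proper T T' :
  T \proper T' -> coalition_value T < coalition_value T'.
Proof.
move=> /fintype.properP[TT' [i iT' iT]].
apply: nu_inc; try exact: coalition_share_itv.
rewrite [ltRHS](big_setID T)/= (finset.setIidPr TT') ltrDl (bigD1 i)/=; last first.
  by rewrite inE iT iT'.
by rewrite ltr_wpDr// sumr_ge0// => j _; exact: ltW.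
Qed.

Lemma coalition_value_subset T T' :
  T \subset T' -> coalition_value T <= coalition_value T'.
Proof.
by rewrite finset.subEproper => /orP[/eqP->//|/coalition_value_proper/ltW].
Qed.

Lemma payoff_le a a' b : (forall i, Delta x i a b < Delta x i a' b) ->
  payoff a b <= payoff a' b.
Proof.
by move=> h; apply: step_mean_le => [|i]; [exact: coalition_value_subset|exact: ltW].
Qed.

(** Only [a] is placed in the box; the hypotheses are symmetric, so exchanging the parties places
    [b]. *)
Lemma mutual_best_reply_in_box a b : (0 < N)%N -> wide_support x phi ->
  (forall a', payoff a' b <= payoff a b) ->
  (forall b', payoff b' a <= payoff b a) -> bliss_box x a.
Proof.
move=> N0 ws ha hb; apply: contrapT => aD.
have [a' Da' aa'] := bliss_box_dominates N0 aD.
(* Otherwise A wins every voter at every shock, and B gets at most the mean at the constant profile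
   [- phi]. Imitating [a] gives the zero profile, which is strictly better. *)
have [i ilt] : exists i, Delta x i a b < phi.
  apply: contrapT => /forallNP h.
  have := hb a; apply/negP; rewrite -ltNge.
  apply: (@le_lt_trans _ _ (step_mean hphi coalition_value (fun=> - phi))).
    apply: step_mean_le => [|i]; first exact: coalition_value_subset.
    by rewrite Delta_opp lerN2 leNgt; apply/negP.
  have p0 := phi_gt0 hphi.
  apply: (@step_mean_lt _ _ _ _ _ _ _ (Ordinal N0)) => [|i|||].
  - exact: coalition_value_proper.
  - by rewrite Deltaxx oppr_le0 ltW.
  - by rewrite Deltaxx oppr_lt0.
  - exact: hphi.
  - by rewrite Deltaxx oppr_lt0.
have := ha a'; apply/negP; rewrite -ltNge.
apply: (@step_mean_lt _ _ _ _ _ _ _ i) => //.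
- exact: coalition_value_proper.
- by move=> j; exact: ltW.
(* Delta x i a' b >= - |a' - x i| ^+ 2 = Delta x i a' (x i) *)
apply: (@lt_le_trans _ _ (Delta x i a' (x i))).
  have := wide_supportP i ws Da' (@bliss_box_bliss _ _ _ x i).
  by rewrite ltr_norml => /andP[].
rewrite /Delta lerD2r subrr enorm_sqr big1 ?sqr_ge0// => k _.
by rewrite mxE expr0n.
Qed.

Lemma payoff_swap mu a b : injective x -> centrally_symmetric s x mu ->
  wide_support x phi -> bliss_box x a -> bliss_box x b ->
  payoff a b - payoff b a =
  (enorm (b - mu) ^+ 2 - enorm (a - mu) ^+ 2) / phi * (nu 1 - nu 0).
Proof.
move=> hx /choice[f fP] ws Da Db.
(* Distinct bliss points make the chosen partner map an involution, hence a permutation of the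
   voters. *)
have ff : involutive f.
  by move=> i; apply: hx; rewrite (fP (f i)).1 (fP i).1 subKr.
have gf T : coalition_value (f @^-1: T) = coalition_value T.
  congr nu; rewrite [RHS](reindex_inj (inv_inj ff))/=.
  by apply: eq_big => [i|i _]; rewrite ?inE// (fP i).2.
set c := enorm (b - mu) ^+ 2 - _.
have Dfab i : Delta x (f i) a b = Delta x i b a + c *+ 2.
  exact: Delta_reflect (fP i).1.
rewrite /payoff -(step_mean_perm _ (fun i => Delta x i a b) gf).
rewrite (_ : _ \o f = (fun i => Delta x i b a + c *+ 2)); last exact/funext.
rewrite step_mean_shift => [|i|i].
(* The factor 2 of the shift cancels against the one in the length of the support. *)
- rewrite -mulr_natr -[phi *+ 2]mulr_natr -mulf_div divff ?pnatr_eq0// mulr1.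
  congr (_ * (nu _ - nu _)); last by rewrite big_set0.
  by rewrite -s_sum1; apply: eq_bigl => i; rewrite inE.
- exact/ltW/wide_supportP.
- by rewrite -Dfab; exact/ltW/wide_supportP.
Qed.

Lemma continuous_payoff : continuous (fun p : 'rV[R]_K * 'rV[R]_K => payoff p.1 p.2).
Proof. by apply: continuous_step_mean => i; exact: continuous_Delta. Qed.

Lemma nash_bliss_box : (0 < N)%N -> wide_support x phi ->
  nash (bliss_box x) payoff (fun a b => payoff b a) =
  nash setT payoff (fun a b => payoff b a).
Proof.
move=> N0 ws; apply/seteqP; split=> -[a b] [/= Da Db ha hb]; last first.
  split=> //=; last by move=> *; exact: hb.
  - by apply: (@mutual_best_reply_in_box a b) => // c; [exact: ha|exact: hb].
  - by apply: (@mutual_best_reply_in_box b a) => // c; [exact: hb|exact: ha].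
  - by move=> *; exact: ha.
(* A deviation [c] outside the box is no better than its dominating point [c'] inside. *)
split=> //= c _; have [Dc|/(bliss_box_dominates N0)[c' Dc' cc']] := pselect (bliss_box x c).
- exact: ha.
- exact: le_trans (payoff_le (cc' ^~ b)) (ha _ Dc').
- exact: hb.
- exact: le_trans (payoff_le (cc' ^~ a)) (hb _ Dc').
Qed.

End Payoffs.

(** * The potential and existence of equilibrium *)

Lemma exact_potential_maximizer_nash (R : realType) (T : Type) (X : set T)
    (VA VB F : T -> T -> R) (p : T * T) :
  exact_potential X VA VB F -> global_maximizer X F p -> nash X VA VB p.
Proof.
move=> [potA potB] [X1 X2 Fmax]; split=> // c Xc; rewrite -subr_le0.
  by rewrite potA// subr_le0 Fmax.
by rewrite potB// subr_le0 Fmax.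
Qed.

Theorem proposition5 (R : realType) (K N : nat) (hK : (2 <= K)%N) (hN : (2 <= N)%N)
  (s : 'I_N -> R) (hs : forall i, 0 < s i) (hs1 : \sum_(i < N) s i = 1)
  (x : 'I_N -> 'rV[R]_K) (hx : injective x)
  (mu : 'rV[R]_K) (hsym : centrally_symmetric s x mu)
  (phi : R) (hphi : - phi < phi) (hwide : wide_support x phi)
  (rho : R -> R) (rhobar : R)
  (hrho : strictly_increasing_on `[0, 1] rho)
  (hrhobar : forall t, 0 <= t -> t <= 1 -> rho t + rho (1 - t) = rhobar)
  (U : R -> R)
  (hUcont : {within `[rho 0, rho 1], continuous U})
  (hUinc : strictly_increasing_on `[rho 0, rho 1] U)
  (hUconc : strictly_concave_on `[rho 0, rho 1] U)
  (hnu : (U \o rho) 1 - (U \o rho) 0 = 1) :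
  let D := bliss_box x in
  let VA := payoffA s x hphi (U \o rho) in
  let VB := payoffB s x hphi (U \o rho) in
  let F := Phi s x hphi (U \o rho) mu in
  [/\ (forall xA xB, D xA -> D xB ->
         F xA xB = VB xA xB - enorm (xA - mu) ^+ 2 / phi),
      exact_potential D VA VB F,
      nash D VA VB = nash setT VA VB,
      (forall p, global_maximizer D F p -> nash setT VA VB p) &
      (exists p, nash setT VA VB p)].
Proof.
move=> D VA VB F.
have N0 : (0 < N)%N by exact: ltn_trans hN.
have rho_mono t u : 0 <= t -> t <= u -> u <= 1 -> rho t <= rho u.
  move=> t0; rewrite le_eqVlt => /orP[/eqP->//|tu] u1; apply/ltW/hrho => //=.
    by rewrite in_itv/= t0 (le_trans (ltW tu)).
  by rewrite in_itv/= u1 andbT (le_trans t0 (ltW tu)).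
have nu_inc : strictly_increasing_on `[0, 1] (U \o rho).
  move=> t u /= tI uI tu; apply: hUinc; last exact: hrho.
    by move: tI; rewrite /= !in_itv/= => /andP[t0 t1]; rewrite !rho_mono.
  by move: uI; rewrite /= !in_itv/= => /andP[u0 u1]; rewrite !rho_mono.
have VAE : VA = payoff s x hphi (U \o rho).
  by apply/funext => a; apply/funext => b; exact: payoffA_payoff.
have VBE : VB = (fun a b => payoff s x hphi (U \o rho) b a).
  by apply/funext => a; apply/funext => b; exact: payoffB_payoff.
have FE a b : F a b = VA a b - enorm (b - mu) ^+ 2 / phi by [].
have FB a b : D a -> D b -> F a b = VB a b - enorm (a - mu) ^+ 2 / phi.
  move=> Da Db; rewrite FE VAE VBE.
  have := payoff_swap hphi (U \o rho) hs1 hx hsym hwide Da Db.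
  by rewrite hnu mulr1 mulrBl; lra.
have pot : exact_potential D VA VB F.
  (* For each deviator, [F] is taken in the form whose subtracted term depends on the opponent's
     platform only. *)
  by split=> a b c Xa Xb Xc; [rewrite !FE|rewrite !FB//]; ring.
have nashE : nash D VA VB = nash setT VA VB.
  by rewrite VAE VBE; exact: nash_bliss_box.
have max_nash p : global_maximizer D F p -> nash setT VA VB p.
  by rewrite -nashE; exact: exact_potential_maximizer_nash.
split=> //.
(* Existence: the continuous potential attains its maximum on the nonempty compact [D] squared. *)
have cD : compact (D `*` D) by apply: compact_setX; exact: compact_bliss_box.
have D0 : (D `*` D) !=set0.
  by exists (x (Ordinal N0), x (Ordinal N0)); split; exact: bliss_box_bliss.
have cF : continuous (fun p : 'rV[R]_K * 'rV[R]_K => F p.1 p.2).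
  have -> : (fun p : 'rV[R]_K * 'rV[R]_K => F p.1 p.2) = (fun p =>
      payoff s x hphi (U \o rho) p.1 p.2
      - (\sum_(k < K) (p.2 ord0 k - mu ord0 k) ^+ 2) / phi).
    apply/funext => p; rewrite FE VAE enorm_sqr; congr (_ - _ / _).
    by apply: eq_bigr => k _; rewrite !mxE.
  move=> p; apply: cvgB; first exact: continuous_payoff.
  apply: cvgM; last exact: cvg_cst.
  by apply: (@continuous_sqr_dist _ _ _ snd) => q; exact: cvg_snd.
have [p pD pmax] := compact_EVT_max D0 cD (continuous_subspaceT cF).
exists p; apply: max_nash; move: pD; rewrite inE => -[D1 D2]; split=> // a b Da Db.
by apply: (pmax (a, b)); rewrite inE.
Qed.
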